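(* A function $f\in O(\mathbb{B})$ belongs to $S^+(\mathbb{B})$ if and only if there exist a Hilbert space $\mathcal{L}$, an isometry $V=(V_1,\dots,V_n):\mathcal{L}^n\to\mathcal{L}$, a vector $\xi\in\mathcal{L}$, and a real number $t$, such that $$f(z)=\left\langle\left[2\Big(I-\sum_{i=1}^n z_iV_i\Big)^{-1}-I\right]\xi,\xi\right\rangle+it\qquad(z\in\mathbb{B}).$$
   Context: $\mathbb{B}$ is the open unit ball of $\mathbb{C}^n$, $\langle z,w\rangle=\sum_i z_i\overline{w_i}$, and $O(\mathbb{B})$ is the space of holomorphic functions on $\mathbb{B}$. The positive Schur class is $$S^+(\mathbb{B})=\left\{f\in O(\mathbb{B}):\ \frac{f(z)+\overline{f(w)}}{1-\langle z,w\rangle}\ \text{is a positive semidefinite kernel on }\mathbb{B}\right\}.$$ A row $V=(V_1,\dots,V_n)$ of bounded operators on $\mathcal{L}$ acts by $V(x_1,\dots,x_n)=\sum_iV_ix_i$; being an isometry means $V_i^*V_j=\delta_{ij}I$. *)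

(* Defs.v *)
From HB Require Import structures.
From mathcomp Require Import all_boot all_order all_algebra.
From mathcomp Require Import sesquilinear.
From mathcomp Require Import complex.
From mathcomp Require Import all_classical all_reals all_analysis.

Set Implicit Arguments.
Unset Strict Implicit.
Unset Printing Implicit Defensive.

Import Order.TTheory GRing.Theory Num.Theory.
Import numFieldNormedType.Exports.

Local Open Scope classical_set_scope.
Local Open Scope ring_scope.

(* MathComp-Analysis attaches the topology and the normed-module structure of
   a field to abstract field structures only, hence not to the concrete R[i]. *)
HB.instance Definition _ (R : realType) := GRing.ComAlgebra.copy R[i] R[i]^o.
HB.instance Definition _ (R : realType) := Vector.copy R[i] R[i]^o.
HB.instance Definition _ (R : realType) := NormedModule.copy R[i] R[i]^o.

(* The form is linear in its first argument, antilinear in the second. *)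
Record hilbertSpace (R : realType) := HilbertSpace {
  hsort :> completeNormedModType R[i];
  inner : {dot hsort for (@Num.conj R[i])};
  inner_normE : forall x : hsort, `|x| ^+ 2 = inner x x }.

Notation "⟪ x , y ⟫" := (inner _ x y) (at level 0, x, y at level 99).

Section Operators.
Context {R : realType} {L : hilbertSpace R}.

Definition bounded_op (T : L -> L) : Prop :=
  linear T /\ exists M : R[i], forall x, `|T x| <= M * `|x|.

Definition is_op_inv (T S : L -> L) : Prop :=
  bounded_op S /\ T \o S = id /\ S \o T = id.

(* Arbitrary when T is not invertible; the operators it is applied to are
   invertible by [pencil_inv] below. *)
Definition op_inv (T : L -> L) : L -> L := get (is_op_inv T).

Lemma op_invE (T S : L -> L) : is_op_inv T S -> op_inv T = S.
Proof.
move=> TS; have [_ [_ gT]] : is_op_inv T (op_inv T).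
  by apply: (@getPex _ (is_op_inv T)); exists S.
case: TS => _ [TS _]; rewrite -[RHS](_ : id \o S = S) //.
by rewrite -gT -compA TS.
Qed.

Lemma geom_small (q M eps : R[i]) : 0 <= q < 1 -> 0 <= M -> 0 < eps ->
  exists N, q ^+ N * M < eps.
Proof.
move=> /andP[q0 q1] M0 e0.
have [M_0|Mn0] := eqVneq M 0; first by exists 0%N; rewrite M_0 mulr0.
have {Mn0} {}M0 : 0 < M by rewrite lt_def Mn0.
suff [N HN] : exists N, q ^+ N < eps / M by exists N; rewrite -ltr_pdivlMr.
have : 0 < eps / M by rewrite divr_gt0.
move: (eps / M) => e {}e0.
have qE : q = (complex.Re q)%:C%C by rewrite RRe_real // ger0_real.
have eE : e = (complex.Re e)%:C%C by rewrite RRe_real // gtr0_real.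
move: q0 q1 e0; rewrite qE eE {qE eE} -(rmorph0 (real_complex R)) -(rmorph1 (real_complex R)) lecR !ltcR.
move: (complex.Re q) (complex.Re e) => r s r0 r1 s0.
have /cvgrPdist_lt/(_ s s0)[N _ HN] : (fun n => r ^+ n) @ \oo --> (0 : R).
  by apply: cvg_expr; rewrite ger0_norm.
exists N; have := HN N (leqnn N).
by rewrite sub0r normrN ger0_norm ?exprn_ge0 // -rmorphXn ltcR.
Qed.

Lemma neumann (T : {linear L -> L}) (q : R[i]) : 0 <= q < 1 ->
  (forall x, `|T x| <= q * `|x|) -> exists S, is_op_inv (fun x => x - T x) S.
Proof.
move=> q01 Tq; have /andP[q0 q1] := q01.
have q1' : 0 < 1 - q by rewrite subr_gt0.
have sub x : (1 - q) * `|x| <= `|x - T x|.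
  rewrite mulrBl mul1r lerBlDr -{1}[x](subrK (T x)).
  by apply: le_trans (ler_normD _ _) _; rewrite lerD2l.
have inj x y : x - T x = y - T y -> x = y.
  move=> xy; apply/eqP; rewrite -subr_eq0 -normr_le0.
  rewrite -(ler_pM2l q1') mulr0; apply: le_trans (sub _) _.
  by rewrite linearB opprD addrACA -opprD xy subrr normr0.
have surj x : exists y, y - T y = x.
  pose u := fix u n := if n is n'.+1 then x + T (u n') else 0 : L.
  pose M := `|x| / (1 - q).
  have M0 : 0 <= M by rewrite divr_ge0 // ltW.
  have uM k : `|u k| <= M.
    elim: k => [|k IH]; first by rewrite normr0.
    have -> : M = `|x| + q * M by rewrite -[q](subKr 1) mulrBl mul1r [X in _ - X]mulrC divfK ?gt_eqF// addrC subrK.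
    apply: le_trans (ler_normD _ _) _; rewrite lerD2l.
    by apply: le_trans (Tq _) _; rewrite ler_wpM2l.
  have uN N k : `|u N - u (N + k)%N| <= q ^+ N * M.
    elim: N => [|N IH]; first by rewrite sub0r normrN mul1r.
    rewrite addSn /= opprD addrACA subrr add0r -linearB exprS -mulrA.
    by apply: le_trans (Tq _) _; rewrite ler_wpM2l.
  have /cauchy_cvg/cvg_ex[l ul] : cauchy (u @ \oo).
    apply/cauchyP => e e0; have [N HN] := geom_small q01 M0 e0.
    exists (u N); exists N => // k /= Nk; rewrite -ball_normE /=.
    by rewrite -(subnKC Nk); apply: le_lt_trans (uN _ _) _.
  have Tc : continuous T.
    apply/linear_bounded_continuous/linear_boundedP; near=> r => y.
    apply: le_trans (Tq y) _; rewrite ler_wpM2r //; near: r.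
    by apply: nbhs_pinfty_ge; rewrite ger0_real.
  exists l; apply/eqP; rewrite subr_eq; apply/eqP.
  apply: (@cvg_unique _ (@norm_hausdorff _ L) (u @ \oo)) => //=.
  rewrite -cvg_shiftS; apply: cvgD; first exact: cvg_cst.
  by apply: continuous_cvg => //; exact: Tc.
have /choice[S HS] := surj.
exists S; split; last first.
  by split; apply/funext => x /=; [exact: HS | apply: inj; rewrite HS].
split.
  move=> a x y; apply: inj.
  by rewrite linearP opprD addrACA -scalerBr !HS.
exists (1 - q)^-1 => x; rewrite mulrC ler_pdivlMr // mulrC.
by apply: le_trans (sub _) _; rewrite HS.
Unshelve. all: by end_near. Qed.

Variable n : nat.

Definition row_op (V : 'I_n -> {linear L -> L}) (x : 'I_n -> L) : L :=
  \sum_i V i (x i).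

(* The norm of the direct sum L^n is the l^2 one. *)
Definition row_isometry (V : 'I_n -> {linear L -> L}) : Prop :=
  forall x : 'I_n -> L, `|row_op V x| ^+ 2 = \sum_i `|x i| ^+ 2.

(* The right-hand side is V_i^* V_j = delta_ij I. *)
Lemma row_isometryP (V : 'I_n -> {linear L -> L}) :
  row_isometry V <->
  forall i j (x y : L), ⟪V j x, V i y⟫ = (i == j)%:R * ⟪x, y⟫.
Proof.
split=> [isoV|orthV x]; last first.
  rewrite inner_normE linear_sumlz; apply: eq_bigr => i _.
  rewrite linear_sumr (bigD1 i) //= orthV eqxx mul1r inner_normE.
  by rewrite big1 ?addr0 // => j ji; rewrite orthV (negPf ji) mul0r.
pose D x y := ⟪row_op V x, row_op V y⟫ - \sum_i ⟪x i, y i⟫.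
have D0 x : D x x = 0.
  by rewrite /D -inner_normE isoV -(eq_bigr _ (fun i _ => inner_normE (x i))) subrr.
have rowD a x y : row_op V (fun k => a *: x k + y k) = a *: row_op V x + row_op V y.
  rewrite /row_op scaler_sumr -big_split /=.
  by apply: eq_bigr => k _; rewrite linearP.
have Dl a x y z : D (fun k => a *: x k + y k) z = a * D x z + D y z.
  rewrite /D rowD linearDl linearZl_LR mulrBr mulr_sumr addrACA -opprD.
  by rewrite -big_split /=; under eq_bigr do rewrite linearDl linearZl_LR.
have Dr a x y z : D z (fun k => a *: x k + y k) = a^* * D z x + D z y.
  rewrite /D rowD linearDr linearZr_LR mulrBr mulr_sumr addrACA -opprD.
  by rewrite -big_split /=; under eq_bigr do rewrite linearDr linearZr_LR.
have polar a x y : a * D x y + a^* * D y x = 0.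
  have := D0 (fun k => a *: x k + y k).
  by rewrite Dl !Dr !D0 mulr0 add0r addr0.
have Dxy x y : D x y = 0.
  have := polar 'i x y; have := polar 1 x y.
  rewrite conjC1 conjCi !mul1r mulNr -mulrBr => /eqP.
  rewrite addr_eq0 => /eqP -> /eqP.
  rewrite mulf_eq0 (negPf (neq0Ci _)) /= -opprD oppr_eq0 -mulr2n mulrn_eq0 /=.
  by move=> /eqP ->; rewrite oppr0.
pose e (k : 'I_n) (x : L) l := if l == k then x else 0.
have row_e k x : row_op V (e k x) = V k x.
  rewrite /row_op (bigD1 k) //= /e eqxx big1 ?addr0 // => l lk.
  by rewrite (negPf lk) linear0.
move=> i j x y; rewrite -!row_e; apply/eqP; rewrite -subr_eq0.
rewrite -[X in _ == X](Dxy (e j x) (e i y)) /D; apply/eqP; congr (_ - _).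
rewrite (bigD1 i) //= /e eqxx; case: eqP => [<-|_].
  rewrite mul1r big1 ?addr0 // => k /negPf ->; exact: linear0r.
rewrite mul0r linear0l add0r big1 // => k /negPf ->; exact: linear0r.
Qed.

Definition pencil (V : 'I_n -> {linear L -> L}) (z : 'rV[R[i]]_n) : L -> L :=
  fun x => x - \sum_i z 0 i *: V i x.

End Operators.

Section Ball.
Context {R : realType} {n : nat}.

Definition cdot (z w : 'rV[R[i]]_n) : R[i] := \sum_i z 0 i * (w 0 i)^*.

Definition cball : set 'rV[R[i]]_n := [set z | cdot z z < 1].

Definition holomorphic (f : 'rV[R[i]]_n -> R[i]) : Prop :=
  forall z, cball z -> differentiable f z.

Definition psd_kernel (D : set 'rV[R[i]]_n)
    (K : 'rV[R[i]]_n -> 'rV[R[i]]_n -> R[i]) : Prop :=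
  forall (m : nat) (p : 'I_m -> 'rV[R[i]]_n) (c : 'I_m -> R[i]),
    (forall k, D (p k)) ->
    0 <= \sum_k \sum_l c k * (c l)^* * K (p k) (p l).

Definition schur_plus : set ('rV[R[i]]_n -> R[i]) :=
  [set f | holomorphic f /\
    psd_kernel cball (fun z w => (f z + (f w)^*) / (1 - cdot z w))].

End Ball.

Lemma pencil_inv {R : realType} {L : hilbertSpace R} n (V : 'I_n -> {linear L -> L}) (z : 'rV[R[i]]_n) :
  row_isometry V -> cball z -> exists S, is_op_inv (pencil V z) S.
Proof.
move=> isoV z1; pose T (x : L) := \sum_i z 0 i *: V i x.
have Tlin : linear T.
  move=> a x y; rewrite /T scaler_sumr -big_split; apply: eq_bigr => i _ /=.
  by rewrite linearP scalerDr !scalerA mulrC.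
have z0 : 0 <= cdot z z by apply: sumr_ge0 => i _; rewrite mul_conjC_ge0.
pose Tl := GRing.isLinear.Build _ _ _ _ T Tlin.
pose T' : {linear L -> L} := HB.pack T Tl.
apply: (@neumann _ L T' (sqrtC (cdot z z))).
  rewrite sqrtC_ge0 z0 /= -[X in _ < X]sqrtC1 ltr_sqrtC ?qualifE ?ler01 ?z0 //. exact: ler01.
move=> x; rewrite -(ler_pXn2r (_ : 0 < 2)%N) ?nnegrE ?mulr_ge0 ?sqrtC_ge0 //.
rewrite exprMn sqrtCK /cdot mulr_suml.
have -> : T' x = row_op V (fun i => z 0 i *: x).
  by rewrite /row_op; apply: eq_bigr => i _; rewrite linearZ.
rewrite isoV le_eqVlt; apply/orP; left; apply/eqP; apply: eq_bigr => i _.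
by rewrite normrZ exprMn normCK.
Qed.

(* Main.v *)
Require Import Defs.
From HB Require Import structures.
From mathcomp Require Import all_boot all_order all_algebra.
From mathcomp Require Import sesquilinear complex ring.
From mathcomp Require Import all_classical all_reals all_analysis.

Set Implicit Arguments.
Unset Strict Implicit.
Unset Printing Implicit Defensive.

Import Order.TTheory GRing.Theory Num.Theory.
Import numFieldNormedType.Exports.

Local Open Scope classical_set_scope.
Local Open Scope ring_scope.

(** Write [K z w] for half of the kernel [(f z + conj (f w)) / (1 - <z, w>)].

    From the formula to positivity: put [a_z = (I - \sum_i z_i V_i)^-1 xi], so
    that [xi = a_z - Z a_z] with [Z = \sum_i z_i V_i].  Because the [V_i] have
    orthonormal ranges, [<Z a_z, W a_w> = <z, w> <a_z, a_w>], and substituting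
    for [xi] gives [f z + conj (f w) = 2 (1 - <z, w>) <a_z, a_w>]
    ([resolvent_kernel]); thus [K z w = <a_z, a_w>] is a Gram kernel.

    From positivity to the formula: realize [K] as a Gram matrix,
    [<a_z, a_w> = K z w].  Since [<0, w> = 0], a direct computation gives
    [<a_z - a_0, a_w - a_0> = <z, w> <a_z, a_w>], that is, the vectors
    [(z_i a_z)_i] of [L^n] and the vectors [a_z - a_0] of [L] have the same Gram
    matrix, and [(z_i a_z)_i |-> a_z - a_0] is a partial isometry (the lurking
    isometry).  An isometry [V] of the whole of [L^n] that extends it satisfies
    [(I - \sum_i z_i V_i) a_z = a_0], and the formula follows with [xi = a_0]
    and [t = Im (f 0)].

    To have room for the extension, [K] is not realized alone but together with
    a row isometry [S] whose range is orthogonal to all the [a_z]: take the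
    kernel [delta_(u, v) K z w] on pairs (word, point), the letters acting on
    words by left concatenation ([shifts]).  The row [S] also embeds [L^n] into
    [L], so everything takes place in a single Hilbert space: if [T] is the
    partial isometry with [T (\sum_i z_i S_i a_z) = a_z - a_0] and [P] is its
    initial projection, the extension is [V_i = (T + I - P) S_i]
    ([extend_row_isometry]).

    Two pieces of Hilbert space theory carry this: every positive kernel is the
    Gram kernel of a total family in some Hilbert space ([kolmogorov]), and two
    families with the same Gram matrix are exchanged by a partial isometry
    ([partial_isometry]). *)

(** * Limits of sequences, in epsilon form *)

Section Limits.
Context {R : realType}.
Local Notation C := R[i].

Definition seq_to (V : normedZmodType C) (u : nat -> V) (l : V) : Prop :=
  forall e : C, 0 < e -> exists N, forall k, (N <= k)%N -> `|u k - l| < e.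

Definition seq_cauchy (V : normedZmodType C) (u : nat -> V) : Prop :=
  forall e : C, 0 < e -> exists N, forall k l, (N <= k)%N -> (N <= l)%N ->
    `|u k - u l| < e.

Lemma real_of_ge0 (e : C) : 0 <= e -> e = (complex.Re e)%:C%C.
Proof. by move=> e0; rewrite RRe_real // ger0_real. Qed.

Lemma half_gt0 (e : C) : 0 < e -> 0 < e / 2.
Proof. by move=> e0; rewrite divr_gt0. Qed.

Lemma half_lt (e : C) : 0 < e -> e / 2 < e.
Proof. by move=> e0; rewrite gtr_pMr // invf_lt1 // ltr1n. Qed.

Section Module.
Context {V : normedZmodType C}.
Implicit Types (u v : nat -> V) (l m : V).

Lemma small_eq0 (x : C) : 0 <= x -> (forall e, 0 < e -> x < e) -> x = 0.
Proof.
move=> x0 xe; apply/eqP/negPn/negP => xn0.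
have := xe x; rewrite lt_def xn0 x0 => /(_ isT).
by rewrite ltxx.
Qed.

Lemma seq_to_unique u l m : seq_to u l -> seq_to u m -> l = m.
Proof.
move=> ul um; apply/eqP; rewrite -subr_eq0 -normr_eq0; apply/eqP.
apply: small_eq0 => // e /half_gt0 e0.
have [N HN] := ul _ e0; have [M HM] := um _ e0.
have := ltrD (HN (maxn N M) (leq_maxl _ _)) (HM (maxn N M) (leq_maxr _ _)).
rewrite -splitr; apply: le_lt_trans.
rewrite -[`|_ - l|]normrN opprB.
by apply: le_trans (ler_normD _ _); rewrite addrA subrK.
Qed.

Lemma seq_to_cst l : seq_to (fun=> l) l.
Proof. by move=> e e0; exists 0%N => k _; rewrite subrr normr0. Qed.

Lemma seq_toD u v l m :
  seq_to u l -> seq_to v m -> seq_to (fun k => u k + v k) (l + m).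
Proof.
move=> ul vm e /half_gt0 e0.
have [N HN] := ul _ e0; have [M HM] := vm _ e0.
exists (maxn N M) => k; rewrite geq_max => /andP[/HN h /HM h'].
rewrite opprD addrACA; apply: le_lt_trans (ler_normD _ _) _.
by rewrite [e]splitr ltrD.
Qed.

Lemma seq_cauchy_of u l : seq_to u l -> seq_cauchy u.
Proof.
move=> ul e /half_gt0 e0; have [N HN] := ul _ e0.
exists N => i j /HN Ni /HN Nj; rewrite [e]splitr.
apply: le_lt_trans (ltrD Ni Nj); rewrite -[`|u j - l|]normrN opprB.
by apply: le_trans (ler_normD _ _); rewrite addrA subrK.
Qed.

Lemma seq_cauchyD u v :
  seq_cauchy u -> seq_cauchy v -> seq_cauchy (fun k => u k + v k).
Proof.
move=> uc vc e /half_gt0 e0.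
have [N HN] := uc _ e0; have [M HM] := vc _ e0.
exists (maxn N M) => k l; rewrite !geq_max => /andP[Nk Mk] /andP[Nl Ml].
rewrite opprD addrACA; apply: le_lt_trans (ler_normD _ _) _.
by rewrite [e]splitr ltrD ?HN ?HM.
Qed.

Lemma seq_cauchy_bounded u : seq_cauchy u ->
  exists2 M : C, 0 < M & forall k, `|u k| <= M.
Proof.
move=> uc; have [N HN] := uc 1 ltr01.
exists (\sum_(k < N) `|u k| + `|u N| + 1).
  by rewrite ltr_wpDl // addr_ge0 ?sumr_ge0.
move=> k; have [kN|Nk] := ltnP k N.
  rewrite (bigD1 (Ordinal kN)) //= -!addrA lerDl.
  by rewrite !addr_ge0 // sumr_ge0.
rewrite -[u k](subrK (u N)); apply: le_trans (ler_normD _ _) _.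
rewrite addrC; apply: lerD; last by rewrite ltW ?HN.
by rewrite ler_wpDl // sumr_ge0.
Qed.

End Module.

Lemma seq_to_dom (V W : normedZmodType C) (M : C) (u : nat -> V) l
    (v : nat -> W) m : 0 <= M -> (forall k, `|u k - l| <= M * `|v k - m|) ->
  seq_to v m -> seq_to u l.
Proof.
move=> M0 dom vm e e0; have M1 : 0 < M + 1 by rewrite ltr_wpDl.
have [|N HN] := vm (e / (M + 1)); first by rewrite divr_gt0.
exists N => k /HN; rewrite ltr_pdivlMr // mulrC; apply: le_lt_trans.
by apply: le_trans (dom k) _; rewrite ler_wpM2r // lerDl.
Qed.

Lemma seq_cauchy_dom (V W : normedZmodType C) (M : C) (u : nat -> V)
    (v : nat -> W) : 0 <= M ->
  (forall k l, `|u k - u l| <= M * `|v k - v l|) ->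
  seq_cauchy v -> seq_cauchy u.
Proof.
move=> M0 dom vc e e0; have M1 : 0 < M + 1 by rewrite ltr_wpDl.
have [|N HN] := vc (e / (M + 1)); first by rewrite divr_gt0.
exists N => k l Nk Nl; have := HN k l Nk Nl.
rewrite ltr_pdivlMr // mulrC; apply: le_lt_trans.
by apply: le_trans (dom _ _) _; rewrite ler_wpM2r // lerDl.
Qed.

Lemma seq_to_lin (a : C) (u v : nat -> C) l m :
  seq_to u l -> seq_to v m -> seq_to (fun k => a * u k + v k) (a * l + m).
Proof.
move=> ul vm; apply: seq_toD => //; apply: (seq_to_dom (normr_ge0 a) _ ul) => k.
by rewrite -mulrBr normrM.
Qed.

Lemma seq_to_conj (u : nat -> C) l :
  seq_to u l -> seq_to (fun k => (u k)^*) l^*.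
Proof.
move=> ul; apply: (seq_to_dom ler01 _ ul) => k.
by rewrite mul1r -rmorphB norm_conjC.
Qed.

Lemma seq_to_shift (V : normedZmodType C) N (u : nat -> V) l :
  seq_to u l -> seq_to (fun k => u (N + k)%N) l.
Proof.
move=> ul e e0; have [M HM] := ul e e0; exists M => k Mk.
by apply: HM; rewrite (leq_trans Mk) // leq_addl.
Qed.

(** A nonnegative complex number is its own modulus, and the modulus is
    continuous. *)
Lemma seq_to_ge0 N (u : nat -> C) l : seq_to u l ->
  (forall k, (N <= k)%N -> 0 <= u k) -> 0 <= l.
Proof.
move=> /(seq_to_shift N) ul u0; suff -> : l = `|l| by [].
apply: (seq_to_unique ul); apply: (seq_to_dom ler01 _ ul) => k.
rewrite mul1r -{1}[u _]ger0_norm ?u0 ?leq_addr //.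
exact: ler_dist_dist.
Qed.

Lemma complex_seq_complete (u : nat -> C) :
  seq_cauchy u -> exists l, seq_to u l.
Proof.
move=> uc.
have part (g : C -> R) : (forall x y, g (x - y) = g x - g y) ->
    (forall x, `|g x|%:C%C <= `|x|) ->
    exists l : R, seq_to (fun k => (g (u k))%:C%C) l%:C%C.
  move=> gB gle.
  have /cauchy_cvg/cvg_ex[l /cvgrPdist_lt ul] : cauchy ((g \o u) @ \oo).
    apply/cauchyP => e e0.
    have [|N HN] := uc e%:C%C; first by rewrite ltcR.
    exists (g (u N)); exists N => // k /= Nk; rewrite -ball_normE /= -gB.
    by rewrite -ltcR; apply: le_lt_trans (gle _) (HN _ _ _ _).
  exists l => e e0; move: e0 (real_of_ge0 (ltW e0)) => /[swap] ->.
  rewrite ltcR => /ul [N _ HN]; exists N => k Nk.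
  rewrite -rmorphB normc_def /= expr0n addr0 sqrtr_sqr ltcR distrC.
  exact: HN.
have [||a ua] := part (@complex.Re R).
- by move=> [? ?] [? ?].
- exact: normc_ge_Re.
have [||b ub] := part (@complex.Im R).
- by move=> [? ?] [? ?].
- move=> x; have := normc_ge_Re (x * 'i%C).
  rewrite ReiNIm normrN normrM [`|'i%C|]normc_def /= expr0n expr1n add0r.
  by rewrite sqrtr1 mulr1.
exists ('i%C * b%:C%C + a%:C%C).
suff -> : u = fun k => 'i%C * (complex.Im (u k))%:C%C + (complex.Re (u k))%:C%C.
  exact: seq_to_lin.
by apply/funext => k; rewrite [LHS]complexE addrC.
Qed.

End Limits.

(** * Inner product spaces from positive semidefinite forms *)

Section CauchySchwarz.
Context {R : realType} (U : lmodType R[i]) (B : U -> U -> R[i]).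
Hypothesis B_linl : forall a x y z, B (a *: x + y) z = a * B x z + B y z.
Hypothesis B_herm : forall x y, B x y = (B y x)^*.
Hypothesis B_ge0 : forall x, 0 <= B x x.

Lemma herm_linr a x y z : B z (a *: x + y) = a^* * B z x + B z y.
Proof. by rewrite B_herm B_linl rmorphD rmorphM /= -!B_herm. Qed.

Lemma herm_expand a x y : B (a *: x + y) (a *: x + y) =
  `|a| ^+ 2 * B x x + (a * B x y + (a * B x y)^*) + B y y.
Proof.
rewrite B_linl !herm_linr mulrDr mulrA -normCK -!addrA.
by congr (_ + (_ + (_ + _))); rewrite rmorphM /= -B_herm.
Qed.

Lemma CauchySchwarz_herm x y : `|B x y| ^+ 2 <= B x x * B y y.
Proof.
(* Positivity of the form at x' + y, where x' = - t conj(B x y) x. *)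
have main (t : R[i]) : t \is Num.real ->
    0 <= t ^+ 2 * `|B x y| ^+ 2 * B x x - (t *+ 2) * `|B x y| ^+ 2 + B y y.
  move=> tr; set b := B x y; have := B_ge0 ((- t * b^*) *: x + y).
  rewrite herm_expand normrM normrN norm_conjC exprMn real_normK //.
  have -> : - t * b^* * b = - (t * `|b| ^+ 2).
    by rewrite -mulrA [b^* * b]mulrC -normCK mulNr.
  rewrite rmorphN /= (CrealP _) ?rpredM ?rpredX ?normr_real //.
  by rewrite -opprD -mulr2n -mulrnAl.
have xr : B x x \is Num.real by rewrite ger0_real.
have [x0|xn0] := eqVneq (B x x) 0.
  rewrite x0 mul0r; have [->|bn0] := eqVneq (B x y) 0.
    by rewrite normr0 expr0n.
  have b2 : `|B x y| ^+ 2 != 0 by rewrite sqrf_eq0 normr_eq0.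
  (* The form vanishes at x, so the inequality is affine in t, and this value
     of t brings it down to -1. *)
  have := main ((B y y + 1) / 2 / `|B x y| ^+ 2).
  rewrite x0 mulr0 sub0r -mulrnAl -[_ / 2 *+ 2]mulr_natr !divfK ?pnatr_eq0 //.
  rewrite opprD addrAC addNr sub0r oppr_ge0 => H.
  have /H : (B y y + 1) / 2 / `|B x y| ^+ 2 \is Num.real.
    by rewrite ger0_real // !divr_ge0 ?exprn_ge0 ?addr_ge0.
  by rewrite real_leNgt ?real0 ?real1 // ltr01.
have x_gt0 : 0 < B x x by rewrite lt_def xn0 B_ge0.
have := main (B x x)^-1; rewrite rpredV xr => /(_ isT).
rewrite mulrAC [_^-1 ^+ 2]expr2 -[_ * B x x]mulrA mulVf // mulr1 -mulrBl mulr2n.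
rewrite opprD addNKr.
by rewrite mulNr addrC subr_ge0 ler_pdivrMl.
Qed.

End CauchySchwarz.

(** Linear combinations only have to make sense through the form, so that formal
    combinations, given as lists, and Cauchy sequences both qualify. *)
Record semiInner (R : realType) := SemiInner {
  si_sort :> Type;
  si_lin : R[i] -> si_sort -> si_sort -> si_sort;
  si_zero : si_sort;
  si : si_sort -> si_sort -> R[i];
  si_linP : forall a x y z, si (si_lin a x y) z = a * si x z + si y z;
  si_zeroP : forall z, si si_zero z = 0;
  si_herm : forall x y, si x y = (si y x)^*;
  si_ge0 : forall x, 0 <= si x x }.

Section Separation.
Context {R : realType} (E : semiInner R).
Local Notation C := R[i].

(** The quotient by the null vectors is realized inside the functions on [E],
    a vector [x] being represented by the functional [<x, . >]; this functional
    forgets exactly the null part of [x]. *)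
Definition representable : {pred E -> C} := fun g => `[< exists x, g = si x >].

Lemma representableP g : reflect (exists x, g = si x) (g \in representable).
Proof. exact: asboolP. Qed.

Lemma representable_submod : GRing.submod_closed representable.
Proof.
split.
  apply/representableP; exists (si_zero E).
  by apply/funext => z; rewrite si_zeroP.
move=> a g h /representableP[x ->] /representableP[y ->].
apply/representableP; exists (si_lin a x y).
by apply/funext => z; rewrite si_linP.
Qed.

HB.instance Definition _ :=
  GRing.isSubmodClosed.Build C (E -> C) representable representable_submod.

Record separated :=
  Separated { functional :> E -> C; _ : functional \in representable }.
HB.instance Definition _ := [isSub of separated for functional].
HB.instance Definition _ := [Choice of separated by <:].
HB.instance Definition _ := [SubChoice_isSubLmodule of separated by <:].

Definition class_of (x : E) : separated :=
  @Separated (si x) (introT (representableP _) (ex_intro _ x erefl)).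

Lemma repr_ex (g : separated) : exists x, g = class_of x.
Proof.
by case: g => g Pg; have /representableP[x gx] := Pg; exists x; apply/val_inj.
Qed.

Definition repr (g : separated) : E := projT1 (cid (repr_ex g)).

Lemma reprK (g : separated) : class_of (repr g) = g.
Proof. by rewrite /repr; case: cid. Qed.

(** The functional [g] evaluated at a representative of [h]; linearity in [g] is
    then definitional, and hermitian symmetry removes the dependence on the
    representative. *)
Definition sep_inner (g h : separated) : C := g (repr h).

Lemma sep_innerE x y : sep_inner (class_of x) (class_of y) = si x y.
Proof.
rewrite /sep_inner /= si_herm.
rewrite -[si _ x]/(functional (class_of (repr (class_of y))) x).
by rewrite reprK /= -si_herm.
Qed.

Lemma class_of_lin a x y :
  class_of (si_lin a x y) = a *: class_of x + class_of y.
Proof. by apply/val_inj/funext => z; rewrite /= si_linP. Qed.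

Lemma sep_inner_herm g h : sep_inner g h = (-1) ^+ false * (sep_inner h g)^*.
Proof. by rewrite mul1r -[g]reprK -[h]reprK !sep_innerE si_herm. Qed.

Lemma sep_inner_linl a g h k :
  sep_inner (a *: g + h) k = a * sep_inner g k + sep_inner h k.
Proof. by []. Qed.

Lemma sep_inner_hermC g h : sep_inner g h = (sep_inner h g)^*.
Proof. by rewrite sep_inner_herm mul1r. Qed.

Lemma sep_inner_ge0 g : 0 <= sep_inner g g.
Proof. by rewrite -[g]reprK sep_innerE si_ge0. Qed.

Lemma sep_inner_eval g y : sep_inner g (class_of y) = g y.
Proof. by rewrite -[g]reprK sep_innerE. Qed.

(** By Cauchy-Schwarz a null vector has the zero functional. *)
Lemma sep_inner_eq0 g : sep_inner g g = 0 -> g = 0.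
Proof.
move=> g0; apply/val_inj/funext => y /=.
have := CauchySchwarz_herm sep_inner_linl sep_inner_hermC sep_inner_ge0
  g (class_of y).
by rewrite g0 mul0r sep_inner_eval -normrX normr_le0 expf_eq0 /= => /eqP ->.
Qed.

Lemma sep_bilinear : bilinear_for *%R (Num.conj \; *%R) sep_inner.
Proof.
split=> [k a g h|k a g h] //=.
exact: (herm_linr sep_inner_linl sep_inner_hermC).
Qed.

HB.instance Definition _ := @bilinear_isBilinear.Build C separated separated C
  *%R (Num.conj \; *%R) sep_inner sep_bilinear.
HB.instance Definition _ := @isHermitianSesquilinear.Build C separated
  false Num.conj sep_inner sep_inner_herm.

Lemma sep_inner_gt0 g : g != 0 -> 0 < sep_inner g g.
Proof.
move=> gn0; rewrite lt_def sep_inner_ge0 andbT.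
by apply: contra_neq gn0; exact: sep_inner_eq0.
Qed.

HB.instance Definition _ :=
  @isDotProduct.Build C separated sep_inner sep_inner_gt0.

Definition sep_norm g := sqrtC (sep_inner g g).

Lemma sep_norm_ge0 g : 0 <= sep_norm g.
Proof. by rewrite sqrtC_ge0 sep_inner_ge0. Qed.

Lemma sep_normD g h : sep_norm (g + h) <= sep_norm g + sep_norm h.
Proof.
rewrite -(@ler_pXn2r _ 2) ?nnegrE ?addr_ge0 ?sep_norm_ge0 // sqrrD !sqrtCK.
rewrite -[g in leLHS]scale1r (herm_expand sep_inner_linl sep_inner_hermC).
rewrite normr1 expr1n !mul1r lerD2r lerD2l.
have nb : `|sep_inner g h| <= sep_norm g * sep_norm h.
  rewrite -(@ler_pXn2r _ 2) ?nnegrE ?mulr_ge0 ?sep_norm_ge0 // exprMn !sqrtCK.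
  exact: (CauchySchwarz_herm sep_inner_linl sep_inner_hermC sep_inner_ge0).
rewrite -mulr_natl -ler_pdivrMl // mulrC -ReE; apply: le_trans nb.
exact: leif_Re_Creal.
Qed.

Lemma sep_normZ a g : sep_norm (a *: g) = `|a| * sep_norm g.
Proof.
rewrite /sep_norm -[a *: g]addr0 (herm_expand sep_inner_linl sep_inner_hermC).
rewrite [sep_inner g 0]sep_inner_hermC [sep_inner 0 g]/(0 : C) rmorph0 mulr0.
rewrite rmorph0 [sep_inner 0 0]/(0 : C) !addr0.
by rewrite sqrtCM ?nnegrE ?exprn_ge0 ?sep_inner_ge0 // exprCK.
Qed.

Lemma sep_norm_eq0 g : sep_norm g = 0 -> g = 0.
Proof. by move/eqP; rewrite sqrtC_eq0 => /eqP/sep_inner_eq0. Qed.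

HB.instance Definition _ := @Lmodule_isNormed.Build C separated sep_norm
  sep_normD sep_normZ sep_norm_eq0.

End Separation.

(** * Completion of an inner product space *)

Lemma inv_small (R : realType) (e : R[i]) : 0 < e ->
  exists N, forall k, (N <= k)%N -> k.+1%:R^-1 < e.
Proof.
move=> e0; move: e0 (real_of_ge0 (ltW e0)) => /[swap] ->; rewrite ltcR => e0.
have [N _ HN] := near_infty_natSinv_lt (PosNum e0).
exists N => k /HN /=; rewrite -ltcR; congr (_ < _).
by rewrite fmorphV rmorph_nat.
Qed.

Section InnerProductNorm.
Context {R : realType} (E : normedModType R[i]).
Context (ip : {dot E for (@Num.conj R[i])}).
Hypothesis ip_normE : forall x : E, `|x| ^+ 2 = ip x x.
Local Notation C := R[i].

Lemma ip_linl a x y z : ip (a *: x + y) z = a * ip x z + ip y z.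
Proof. by rewrite linearDl linearZl_LR. Qed.

Lemma ipZ a b x y : ip (a *: x) (b *: y) = a * b^* * ip x y.
Proof. by rewrite linearZl_LR linearZr_LR /= mulrA. Qed.

Lemma ip_herm x y : ip x y = (ip y x)^*.
Proof. by rewrite [LHS]hermC expr0 mul1r. Qed.

Lemma ip_ge0 x : 0 <= ip x x.
Proof. by rewrite -ip_normE exprn_ge0. Qed.

Lemma norm_comb m (c : 'I_m -> C) (a : 'I_m -> E) :
  `|\sum_k c k *: a k| ^+ 2 = \sum_k \sum_l c k * (c l)^* * ip (a k) (a l).
Proof.
rewrite ip_normE linear_sumlz; apply: eq_bigr => k _.
by rewrite linear_sumr; apply: eq_bigr => l _; exact: ipZ.
Qed.

Lemma norm_ip_le x y : `|ip x y| <= `|x| * `|y|.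
Proof.
rewrite -(@ler_pXn2r _ 2) ?nnegrE ?mulr_ge0 // exprMn !ip_normE.
exact: CauchySchwarz_herm ip_linl ip_herm ip_ge0 x y.
Qed.

Lemma ip_seq_to u l x : seq_to u l -> seq_to (fun k => ip (u k) x) (ip l x).
Proof.
move=> ul; apply: (seq_to_dom (normr_ge0 x) _ ul) => k.
by rewrite -linearBl mulrC norm_ip_le.
Qed.

(** If [v] is orthogonal to [y], then [|v|^2 = <v, v - y> <= |v| |v - y|], and
    [y] may be taken arbitrarily close to [v]. *)
Lemma ip_dense_eq0 (D : set E) v :
  (forall x e, 0 < e -> exists2 y, D y & `|y - x| < e) ->
  (forall y, D y -> ip v y = 0) -> v = 0.
Proof.
move=> Ddense vD; apply/eqP; rewrite -normr_eq0; apply/eqP.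
apply: small_eq0 => // e e0; have [y Dy vy] := Ddense v e e0.
have [->|vn0] := eqVneq v 0; first by rewrite normr0.
have v0 : 0 < `|v| by rewrite normr_gt0.
apply: le_lt_trans vy; rewrite -(ler_pM2l v0) -expr2 ip_normE.
have -> : ip v v = - ip v (y - v).
  by rewrite linearBr /= (vD y) // sub0r opprK.
apply: le_trans (norm_ip_le _ _); rewrite -normrN ger0_norm //.
by rewrite linearBr /= (vD y) // sub0r opprK ip_ge0.
Qed.

Lemma ip_seq_cauchy u v : seq_cauchy u -> seq_cauchy v ->
  seq_cauchy (fun k => ip (u k) (v k)).
Proof.
move=> uc vc; have [M M0 uM] := seq_cauchy_bounded uc.
have [M' M'0 vM] := seq_cauchy_bounded vc.
have S0 : 0 < M + M' by rewrite addr_gt0.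
move=> e e0; have eS : 0 < e / 2 / (M + M') by rewrite divr_gt0 // half_gt0.
have [N HN] := uc _ eS; have [N' HN'] := vc _ eS.
exists (maxn N N') => k l; rewrite !geq_max => /andP[Nk N'k] /andP[Nl N'l].
have -> : ip (u k) (v k) - ip (u l) (v l)
          = ip (u k - u l) (v k) + ip (u l) (v k - v l).
  by rewrite linearBl linearBr addrA subrK.
apply: le_lt_trans (ler_normD _ _) _.
apply: (@le_lt_trans _ _ (e / 2)); last exact: half_lt.
rewrite -[X in _ <= X](divfK (lt0r_neq0 S0)) mulrDr addrC.
apply: lerD; apply: le_trans (norm_ip_le _ _) _.
  by rewrite mulrC ler_pM // ltW // HN'.
by rewrite ler_pM // ltW // HN.
Qed.

End InnerProductNorm.

Section Completion.
Context {R : realType} (E : normedModType R[i]).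
Context (ip : {dot E for (@Num.conj R[i])}).
Hypothesis ip_normE : forall x : E, `|x| ^+ 2 = ip x x.
Local Notation C := R[i].

Definition cauchySeq := {u : nat -> E | seq_cauchy u}.

Definition limit (u : nat -> C) : C := xget 0 [set l | seq_to u l].

Lemma limitE u l : seq_to u l -> limit u = l.
Proof.
move=> ul; apply: (seq_to_unique _ ul).
by apply: (@xgetPex _ 0 [set l | seq_to u l]); exists l.
Qed.

(** The limit of the inner products is a semidefinite form on Cauchy sequences;
    the completion is the space that separates it. *)
Definition cauchy_ip (u v : cauchySeq) : C :=
  limit (fun k => ip (sval u k) (sval v k)).

Lemma cauchy_ipP (u v : cauchySeq) :
  seq_to (fun k => ip (sval u k) (sval v k)) (cauchy_ip u v).
Proof.
have uv := ip_seq_cauchy ip_normE (svalP u) (svalP v).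
have [l ul] := complex_seq_complete uv.
by rewrite /cauchy_ip (limitE ul).
Qed.

Lemma seq_cauchyZ a (u : nat -> E) :
  seq_cauchy u -> seq_cauchy (fun k => a *: u k).
Proof.
move=> uc; apply: (seq_cauchy_dom (normr_ge0 a) _ uc) => k l.
by rewrite -scalerBr normrZ.
Qed.

Definition cauchy_lin a (u v : cauchySeq) : cauchySeq :=
  exist _ _ (seq_cauchyD (seq_cauchyZ a (svalP u)) (svalP v)).

Definition cauchy_cst (x : E) : cauchySeq :=
  exist _ _ (seq_cauchy_of (seq_to_cst x)).

Lemma cauchy_linP a x y z :
  cauchy_ip (cauchy_lin a x y) z = a * cauchy_ip x z + cauchy_ip y z.
Proof.
apply: limitE => /=; under eq_fun do rewrite linearDl linearZl_LR.
exact: seq_to_lin (cauchy_ipP _ _) (cauchy_ipP _ _).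
Qed.

Lemma cauchy_zeroP z : cauchy_ip (cauchy_cst 0) z = 0.
Proof.
apply: limitE => /=; under eq_fun do rewrite linear0l.
exact: seq_to_cst.
Qed.

Lemma cauchy_herm x y : cauchy_ip x y = (cauchy_ip y x)^*.
Proof.
apply: limitE; have := seq_to_conj (cauchy_ipP y x).
by under eq_fun do rewrite -ip_herm.
Qed.

Lemma cauchy_ge0 x : 0 <= cauchy_ip x x.
Proof.
by apply: (@seq_to_ge0 _ 0 _ _ (cauchy_ipP x x)) => k _; apply: ip_ge0.
Qed.

Definition completion_semi : semiInner R :=
  SemiInner cauchy_linP cauchy_zeroP cauchy_herm cauchy_ge0.

Local Notation L := (separated completion_semi).

Definition embed (x : E) : L := class_of (cauchy_cst x : completion_semi).

Lemma embed_ip x y : sep_inner (embed x) (embed y) = ip x y.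
Proof. by rewrite sep_innerE; apply: limitE; apply: seq_to_cst. Qed.

Lemma sep_normE (F : semiInner R) (x : separated F) : `|x| ^+ 2 = sep_inner x x.
Proof. by rewrite /Num.norm /= sqrtCK. Qed.

(** The squared distance from [embed (u m)] to the class of [u] is the limit in
    [k] of [|u m - u k|^2], which is small once [m] is large. *)
Lemma embed_to (u : cauchySeq) :
  seq_to (fun k => embed (sval u k)) (class_of (u : completion_semi)).
Proof.
move=> e e0; have [N HN] := svalP u _ (half_gt0 e0); exists N => m Nm.
pose d : cauchySeq := cauchy_lin (-1) u (cauchy_cst (sval u m)).
have -> : embed (sval u m) - class_of (u : completion_semi)
  = class_of (d : completion_semi).
  by rewrite (class_of_lin (-1) (u : completion_semi)) scaleN1r addrC.
apply: (@le_lt_trans _ _ (e / 2)); last exact: half_lt.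
have e2 : 0 <= e / 2 by rewrite ltW ?half_gt0.
rewrite -(@ler_pXn2r _ 2) ?nnegrE // sep_normE sep_innerE -subr_ge0.
pose gap k := (e / 2) ^+ 2 - `|sval u m - sval u k| ^+ 2.
apply: (@seq_to_ge0 _ N gap).
  have := seq_to_lin (-1) (cauchy_ipP d d) (seq_to_cst ((e / 2) ^+ 2)).
  rewrite mulN1r addrC; congr seq_to; apply/funext => k.
  by rewrite mulN1r -ip_normE /= scaleN1r addrC [- _ + _]addrC.
move=> k Nk; rewrite subr_ge0 ler_pXn2r ?nnegrE //.
by apply/ltW; exact: HN.
Qed.

Lemma embed_dense (x : L) e : 0 < e -> exists y, `|embed y - x| < e.
Proof.
move=> e0; have [N HN] := embed_to (repr x) e0.
by exists (sval (repr x) N); have := HN N (leqnn N); rewrite reprK.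
Qed.

Lemma embed_lin a x y : embed (a *: x + y) = a *: embed x + embed y.
Proof. by rewrite -class_of_lin; congr class_of; apply: eq_exist. Qed.

Lemma embed0 : embed 0 = 0.
Proof. by have := embed_lin (-1) 0 0; rewrite scaler0 addr0 scaleN1r addNr. Qed.

Lemma embedB x y : `|embed x - embed y| = `|x - y|.
Proof.
have -> : embed x - embed y = embed (x - y).
  by rewrite addrC -scaleN1r -embed_lin scaleN1r addrC.
by apply/eqP; rewrite -(@eqrXn2 _ 2) // sep_normE ip_normE embed_ip.
Qed.

(** A Cauchy filter has arbitrarily small balls, which by density may be centred
    at points [embed (u k)]; the sequence [u] of centres is then Cauchy in [E],
    and its class is the limit of the filter. *)
Lemma completion_complete (F : set_system L) :
  ProperFilter F -> cauchy F -> cvg F.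
Proof.
move=> FF /cauchyP Fc.
have ex k : exists x : E, F (ball (embed x) (k.+1%:R^-1)).
  have k0 : 0 < k.+1%:R^-1 / 2 :> C by rewrite half_gt0 // invr_gt0 ltr0Sn.
  have [y Fy] := Fc _ k0; have [x xy] := embed_dense y k0.
  exists x; apply: filterS Fy => z; rewrite -!ball_normE /= => yz.
  rewrite [X in _ < X]splitr; apply: le_lt_trans (ltrD xy yz).
  exact: ler_distD.
have {ex} /choice[u Fu] := ex.
have uc : seq_cauchy u.
  move=> e /half_gt0/inv_small[N HN]; exists N => k l /HN Nk /HN Nl.
  have /filter_ex[z] :
      F (ball (embed (u k)) k.+1%:R^-1 `&` ball (embed (u l)) l.+1%:R^-1).
    exact: filterI.
  rewrite -!ball_normE /= => -[kz lz]; rewrite -embedB [e]splitr.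
  apply: le_lt_trans (ltrD (lt_trans kz Nk) (lt_trans lz Nl)).
  by rewrite [`|embed (u l) - z|]distrC ler_distD.
apply/cvg_ex; exists (class_of (exist _ u uc : completion_semi)).
apply/cvg_ballP => e /half_gt0 e0.
have [N HN] := inv_small e0; have [M HM] := embed_to (exist _ u uc) e0.
apply: filterS (Fu (maxn N M)) => z; rewrite -!ball_normE /= => kz.
have zN := lt_trans kz (HN _ (leq_maxl N M)).
rewrite [e]splitr; apply: le_lt_trans (ltrD (HM _ (leq_maxr N M)) zN).
by rewrite [`|embed _ - _|]distrC ler_distD.
Qed.

Definition completion : hilbertSpace R :=
  HilbertSpace
    (hsort := HB.pack_for (completeNormedModType C) L
                (Uniform_isComplete.Build L completion_complete))
    (inner := @sep_inner R completion_semi : {dot L for _}) (@sep_normE _).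

End Completion.

(** * Positive kernels are Gram kernels *)

(** Formal combinations are lists of weighted points, and may repeat a point. *)
Definition positive_kernel (R : realType) (X : Type) (K : X -> X -> R[i]) :=
  forall s : seq (R[i] * X),
    0 <= \sum_(p <- s) \sum_(q <- s) p.1 * q.1^* * K p.2 q.2.

Section Kernel.
Context {R : realType} (X : Type) (K : X -> X -> R[i]).
Local Notation C := R[i].
Hypothesis K_herm : forall x y, K x y = (K y x)^*.
Hypothesis K_psd : positive_kernel K.

Definition comb_ip (s t : seq (C * X)) : C :=
  \sum_(p <- s) \sum_(q <- t) p.1 * q.1^* * K p.2 q.2.

Definition comb_lin a (s t : seq (C * X)) :=
  [seq (a * p.1, p.2) | p <- s] ++ t.

Lemma comb_linP a s t r :
  comb_ip (comb_lin a s t) r = a * comb_ip s r + comb_ip t r.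
Proof.
rewrite /comb_ip big_cat big_map mulr_sumr; congr (_ + _).
apply: eq_bigr => p _ /=; rewrite mulr_sumr.
by apply: eq_bigr => q _; rewrite !mulrA.
Qed.

Lemma comb_herm s t : comb_ip s t = (comb_ip t s)^*.
Proof.
rewrite /comb_ip exchange_big rmorph_sum; apply: eq_bigr => q _ /=.
rewrite rmorph_sum; apply: eq_bigr => p _ /=.
by rewrite !rmorphM /= conjCK -K_herm [q.1 ^* * _]mulrC.
Qed.

Lemma comb_zeroP t : comb_ip [::] t = 0.
Proof. exact: big_nil. Qed.

Definition kernel_semi : semiInner R :=
  SemiInner comb_linP comb_zeroP comb_herm K_psd.

(** Kolmogorov decomposition: separate the formal combinations of points, then
    complete.  Totality of the family holds because the combinations of points
    are dense in the completion. *)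
Theorem kolmogorov : exists (L : hilbertSpace R) (phi : X -> L),
  (forall x y, ⟪phi x, phi y⟫ = K x y) /\
  (forall v, (forall x, ⟪v, phi x⟫ = 0) -> v = 0).
Proof.
pose E := separated kernel_semi.
pose ip : {dot E for _} := @sep_inner R kernel_semi.
have ipE : forall x : E, `|x| ^+ 2 = ip x x by exact: sep_normE.
pose L := completion ipE.
pose point x : E := class_of ([:: (1, x)] : kernel_semi).
pose phi x : L := embed ipE (point x).
exists L, phi; split.
  move=> x y; rewrite [LHS]embed_ip [LHS]sep_innerE /=.
  by rewrite /comb_ip !big_seq1 /= conjC1 !mul1r.
move=> v v0; pose D : set L := [set embed ipE y | y in setT].
apply: (@ip_dense_eq0 _ L (inner L) (@inner_normE _ L) D).
  move=> x e e0.
  have [y xy] := embed_dense (x : separated (completion_semi ipE)) e0.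
  by exists (embed ipE y) => //; exists y.
move=> _ [y _ <-]; rewrite -[y]reprK; elim: (repr y) => [|[a x] s IH].
  have -> : class_of ([::] : kernel_semi) = 0 :> E.
    by apply/val_inj/funext => z /=; exact: comb_zeroP.
  by rewrite embed0 linear0r.
have -> : class_of ((a, x) :: s : kernel_semi)
  = a *: point x + class_of (s : kernel_semi) :> E.
  by rewrite -class_of_lin /= /comb_lin /= mulr1.
by rewrite embed_lin linearDr linearZr_LR /= IH v0 mulr0 addr0.
Qed.

End Kernel.

(** * Partial isometries between families with the same Gram matrix *)

Lemma hilbert_seq_complete (R : realType) (L : hilbertSpace R) (u : nat -> L) :
  seq_cauchy u -> exists l, seq_to u l.
Proof.
move=> uc; have /cauchy_cvg/cvg_ex[l /cvgrPdist_lt ul] : cauchy (u @ \oo).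
  apply/cauchyP => e e0; have [N HN] := uc e e0.
  by exists (u N); exists N => // k /= Nk; rewrite -ball_normE /=; apply: HN.
by exists l => e /ul[N _ HN]; exists N => k /HN /=; rewrite distrC.
Qed.

Section PartialIsometry.
Context {R : realType} (L : hilbertSpace R) (I : Type) (m b : I -> L).
Local Notation C := R[i].
Hypothesis gram : forall i j, ⟪m i, m j⟫ = ⟪b i, b j⟫.
Local Notation linl := (ip_linl (inner L)).
Local Notation herm := (ip_herm (inner L)).
Local Notation ip0 := (ip_ge0 (@inner_normE _ L)).

(** The bipolar, in [L x L] with the form [<p, v> - <t, w>], of the pairs
    [(m i, b i)]: it is the closed span of these pairs, that is, the graph of
    the isometry from the closed span of [m] to that of [b].  Being a bipolar it
    is closed and linear at once, and taking for [(v, w)] another pair of the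
    graph shows that it is isometric. *)
Definition graph (p t : L) : Prop :=
  forall v w, (forall i, ⟪m i, v⟫ = ⟪b i, w⟫) -> ⟪p, v⟫ = ⟪t, w⟫.

Lemma graph_gen i : graph (m i) (b i).
Proof. by move=> v w; apply. Qed.

Lemma graph0 : graph 0 0.
Proof. by move=> v w _; rewrite !linear0l. Qed.

Lemma graph_lin a p t p' t' :
  graph p t -> graph p' t' -> graph (a *: p + p') (a *: t + t').
Proof. by move=> pt pt' v w vw; rewrite !linl (pt v w) ?(pt' v w). Qed.

Lemma graph_iso p t p' t' : graph p t -> graph p' t' -> ⟪p, p'⟫ = ⟪t, t'⟫.
Proof.
move=> pt pt'; apply: pt => i; rewrite herm [RHS]herm; congr _^*.
by apply: pt' => j; apply: gram.
Qed.

Lemma graph_norm p t : graph p t -> `|t| = `|p|.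
Proof.
move=> pt; apply/eqP.
by rewrite -(@eqrXn2 _ 2) // !inner_normE (graph_iso pt pt).
Qed.

Lemma graph_closed (p t : nat -> L) p' t' : (forall k, graph (p k) (t k)) ->
  seq_to p p' -> seq_to t t' -> graph p' t'.
Proof.
move=> pt pp tt v w vw.
have := ip_seq_to (@inner_normE _ L) v pp; move/seq_to_unique; apply.
have := ip_seq_to (@inner_normE _ L) w tt; congr seq_to.
by apply/funext => k; rewrite (pt k v w).
Qed.

Lemma parallelogram (x y : L) :
  `|x - y| ^+ 2 = 2 * `|x| ^+ 2 + 2 * `|y| ^+ 2 - `|x + y| ^+ 2.
Proof.
rewrite !inner_normE !(linearBl, linearBr, linearDl, linearDr) /=.
ring.
Qed.

(** Compare [y] with its distance to the line through [q]: the best multiple of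
    [q] improves [|y|^2] by [|<y, q>|^2 / |q|^2], which cannot exceed [delta]. *)
Lemma near_minimizer (d delta : C) (y q : L) : `|y| ^+ 2 <= d + delta ->
  (forall a, d <= `|a *: q + y| ^+ 2) -> `|⟪y, q⟫| ^+ 2 <= delta * `|q| ^+ 2.
Proof.
move=> yd dmin; have [->|qn0] := eqVneq q 0.
  by rewrite linear0r !normr0 expr0n mulr0.
have q0 : 0 < `|q| ^+ 2 by rewrite exprn_gt0 // normr_gt0.
have := dmin (- (⟪y, q⟫ / `|q| ^+ 2)).
rewrite [`|_ + y| ^+ 2]inner_normE (herm_expand linl herm) -!inner_normE.
rewrite normrN normf_div.
rewrite [X in _ / X]ger0_norm ?exprn_ge0 // [⟪q, y⟫]herm.
set n := `|q| ^+ 2.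
have -> : - (⟪y, q⟫ / n) * ⟪y, q⟫^* = - (`|⟪y, q⟫| ^+ 2 / n).
  by rewrite normCK; ring.
rewrite (CrealP _); last first.
  by rewrite rpredN rpredM ?rpredX ?rpredV ?normr_real // ger0_real ?ltW.
set c := `|⟪y, q⟫|.
have -> : (c / n) ^+ 2 * n + (- (c ^+ 2 / n) - c ^+ 2 / n) + `|y| ^+ 2
  = `|y| ^+ 2 - c ^+ 2 / n by field; rewrite gt_eqF.
rewrite -ler_pdivrMr // lerBrDr => /le_trans/(_ yd).
by rewrite lerD2l.
Qed.

(** The orthogonal projection on the domain of the graph.  A sequence [p k] in
    the domain that minimizes the distance to [x] is Cauchy by the parallelogram
    law; the second components are Cauchy too since the graph is isometric, so
    the limit pair stays in the graph. *)
Lemma graph_projection x :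
  exists p t, graph p t /\ forall p' t', graph p' t' -> ⟪x - p, p'⟫ = 0.
Proof.
pose S : set R := [set r | exists p t, graph p t /\ `|x - p| ^+ 2 = r%:C%C].
have S_norm p t : graph p t -> S (complex.Re (`|x - p| ^+ 2)).
  by move=> pt; exists p, t; split=> //; rewrite -real_of_ge0 // exprn_ge0.
have Slb : lbound S 0.
  by move=> r [p [t [_ pr]]]; rewrite -ler0c -pr exprn_ge0.
have Sinf : has_inf S.
  split; last by exists 0.
  by exists (complex.Re (`|x - 0| ^+ 2)); apply: S_norm graph0.
pose d : C := (inf S)%:C%C.
have dmin p t : graph p t -> d <= `|x - p| ^+ 2.
  move=> /S_norm /(ge_inf (proj2 Sinf)).
  by rewrite (real_of_ge0 (exprn_ge0 2 (normr_ge0 (x - p)))) lecR.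
have ex k : exists pt : L * L,
    graph pt.1 pt.2 /\ `|x - pt.1| ^+ 2 < d + k.+1%:R^-1.
  have k0 : 0 < k.+1%:R^-1 :> R by rewrite invr_gt0 ltr0Sn.
  have [r [p [t [pt pr]]] rd] := inf_adherent k0 Sinf.
  exists (p, t); split=> //=; rewrite pr; move: rd.
  rewrite -ltcR rmorphD fmorphV.
  by rewrite rmorph_nat.
have {ex} /choice[pt] := ex.
pose p k := (pt k).1; pose t k := (pt k).2 => Hpt.
have pt_graph k : graph (p k) (t k) by case: (Hpt k).
have p_lt k : `|x - p k| ^+ 2 < d + k.+1%:R^-1 by case: (Hpt k).
have p_close k l : `|p k - p l| ^+ 2 <= 2 * (k.+1%:R^-1 + l.+1%:R^-1).
  have -> : p k - p l = (x - p l) - (x - p k).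
    by rewrite opprB [RHS]addrC addrA subrK.
  rewrite parallelogram.
  (* The midpoint of p k and p l is in the domain as well. *)
  have mid : 4 * d <= `|x - p l + (x - p k)| ^+ 2.
    have -> : x - p l + (x - p k) = 2 *: (x - (2^-1 *: (p l) + 2^-1 *: p k)).
      rewrite scalerBr scalerDr !scalerA divff ?pnatr_eq0 // !scale1r.
      by rewrite scaler_nat mulr2n opprD addrACA.
    rewrite normrZ exprMn ger0_norm // -natrX ler_pM2l //.
    have := graph_lin 2^-1 (pt_graph l) (graph_lin 2^-1 (pt_graph k) graph0).
    by rewrite !addr0 => /dmin.
  have := lerD (ltW (p_lt l)) (ltW (p_lt k)).
  rewrite -(ler_pM2l (_ : 0 < 2)) // mulrDr => sum.
  by apply: le_trans (lerB sum mid) _; rewrite le_eqVlt; apply/orP; left;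
    apply/eqP; ring.
have pc : seq_cauchy p.
  move=> e e0; have e4 : 0 < e ^+ 2 / 4 by rewrite divr_gt0 // exprn_gt0.
  have [N HN] := inv_small e4; exists N => k l /HN Nk /HN Nl.
  rewrite -(@ltr_pXn2r _ 2) ?nnegrE ?(ltW e0) //.
  apply: le_lt_trans (p_close k l) _; rewrite -ltr_pdivlMl //.
  apply: lt_le_trans (ltrD Nk Nl) _.
  by rewrite le_eqVlt; apply/orP; left; apply/eqP; field.
have tc : seq_cauchy t.
  apply: (seq_cauchy_dom ler01 _ pc) => k l; rewrite mul1r.
  have := graph_norm (graph_lin (-1) (pt_graph l) (pt_graph k)).
  by rewrite !scaleN1r addrC [- _ + _]addrC => ->.
have [p' pp'] := hilbert_seq_complete pc.
have [t' tt'] := hilbert_seq_complete tc.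
exists p', t'; split; first exact: graph_closed pt_graph pp' tt'.
move=> q s qs.
have to1 : seq_to (fun k => ⟪x - p k, q⟫) ⟪x - p', q⟫.
  apply: (ip_seq_to (@inner_normE _ L)); apply: (seq_to_dom ler01 _ pp') => k.
  by rewrite mul1r opprB addrC addrA subrK distrC.
apply: (seq_to_unique to1) => e e0.
have e2 : 0 < e ^+ 2 / (`|q| ^+ 2 + 1).
  by rewrite divr_gt0 ?exprn_gt0 // ltr_wpDl ?exprn_ge0.
have [N HN] := inv_small e2; exists N => k /HN Nk.
rewrite subr0 -(@ltr_pXn2r _ 2) ?nnegrE ?(ltW e0) //.
apply: (@le_lt_trans _ _ (k.+1%:R^-1 * `|q| ^+ 2)).
  apply: near_minimizer (ltW (p_lt k)) _ => a.
  have -> : a *: q + (x - p k) = x - ((- a) *: q + p k).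
    by rewrite opprD scaleNr opprK addrCA.
  exact: dmin (graph_lin _ qs (pt_graph k)).
apply: (@le_lt_trans _ _ (k.+1%:R^-1 * (`|q| ^+ 2 + 1))).
  by rewrite ler_pM2l ?invr_gt0 ?ltr0Sn // lerDl.
by rewrite -ltr_pdivlMr // ltr_wpDl ?exprn_ge0.
Qed.

Lemma graph_unique x p t p' t' : graph p t -> graph p' t' ->
  (forall q s, graph q s -> ⟪x - p, q⟫ = 0) ->
  (forall q s, graph q s -> ⟪x - p', q⟫ = 0) -> p = p' /\ t = t'.
Proof.
move=> pt pt' xp xp'.
have d := graph_lin (-1) pt' pt; rewrite !scaleN1r in d.
have p0 : - p' + p = 0.
  apply/eqP; rewrite -normr_eq0 -sqrf_eq0 inner_normE.
  have {1}-> : - p' + p = (x - p') - (x - p).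
    by rewrite opprB [RHS]addrC addrA subrK addrC.
  by rewrite linearBl /= (xp _ _ d) (xp' _ _ d) subrr.
have t0 : - t' + t = 0.
  by apply/eqP; rewrite -normr_eq0 (graph_norm d) p0 normr0.
by split; apply/eqP; rewrite -subr_eq0 addrC ?p0 ?t0.
Qed.

(** [P] is the initial projection of the partial isometry [T]; the last two
    clauses say that they map into the closed spans of [m] and of [b]. *)
Theorem partial_isometry : exists P T : {linear L -> L},
  [/\ forall x y, ⟪T x, T y⟫ = ⟪P x, P y⟫,
      forall x y, ⟪x - P x, P y⟫ = 0,
      forall i, P (m i) = m i /\ T (m i) = b i,
      forall v, (forall i, ⟪m i, v⟫ = 0) -> forall x, ⟪P x, v⟫ = 0 &
      forall v, (forall i, ⟪b i, v⟫ = 0) -> forall x, ⟪T x, v⟫ = 0].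
Proof.
have /choice[pt] : forall x, exists pt : L * L, graph pt.1 pt.2 /\
    forall p' t', graph p' t' -> ⟪x - pt.1, p'⟫ = 0.
  by move=> x; have [p [t H]] := graph_projection x; exists (p, t).
pose P x := (pt x).1; pose T x := (pt x).2 => H.
have PT x : graph (P x) (T x) by case: (H x).
have orth x p t : graph p t -> ⟪x - P x, p⟫ = 0 by case: (H x) => _; apply.
have uniq x p t : graph p t -> (forall q s, graph q s -> ⟪x - p, q⟫ = 0) ->
    P x = p /\ T x = t.
  by move=> xpt xq; apply: (graph_unique (PT x) xpt _ xq); apply: orth.
have lin a x y :
    P (a *: x + y) = a *: P x + P y /\ T (a *: x + y) = a *: T x + T y.
  apply: uniq; first exact: graph_lin.
  move=> q s qs; rewrite opprD addrACA -scalerBr.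
  by rewrite linl !(orth _ _ _ qs) mulr0 addr0.
have Plin : linear P by move=> a x y; case: (lin a x y).
have Tlin : linear T by move=> a x y; case: (lin a x y).
pose Pm := GRing.isLinear.Build _ _ _ _ P Plin.
pose Tm := GRing.isLinear.Build _ _ _ _ T Tlin.
pose P' : {linear L -> L} := HB.pack P Pm.
pose T' : {linear L -> L} := HB.pack T Tm.
exists P', T'; split => /=.
- by move=> x y; rewrite (graph_iso (PT x) (PT y)).
- by move=> x y; apply: orth (PT y).
- by move=> i; apply: uniq (graph_gen i) _ => q s _; rewrite subrr linear0l.
- move=> v mv x; rewrite (PT x v 0) ?linear0r // => i.
  by rewrite mv linear0r.
- move=> v bv x; rewrite -(PT x 0 v) ?linear0r // => i.
  by rewrite bv linear0r.
Qed.

End PartialIsometry.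

(** * The Herglotz formula gives a positive kernel *)

Section Herglotz.
Context {R : realType} {n : nat}.
Local Notation C := R[i].
Implicit Types (f : 'rV[C]_n -> C) (z w : 'rV[C]_n).

Lemma row_ip (L : hilbertSpace R) (S : 'I_n -> {linear L -> L})
    (a b : 'I_n -> C) x y : row_isometry S ->
  ⟪\sum_i a i *: S i x, \sum_i b i *: S i y⟫
    = (\sum_i a i * (b i)^*) * ⟪x, y⟫.
Proof.
move=> /row_isometryP orth; rewrite linear_sumlz mulr_suml.
apply: eq_bigr => i _; rewrite linear_sumr (bigD1 i) //= big1 => [|j ji].
  by rewrite linearZl_LR linearZr_LR /= orth eqxx mul1r addr0 mulrA.
by rewrite linearZl_LR linearZr_LR /= orth (negPf ji) mul0r !mulr0.
Qed.

Lemma cdot_herm z w : cdot z w = (cdot w z)^*.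
Proof.
rewrite /cdot rmorph_sum; apply: eq_bigr => i _.
by rewrite rmorphM /= conjCK mulrC.
Qed.

(** By Cauchy-Schwarz [|<z, w>| < 1] on the ball, so the denominator of the
    kernel does not vanish. *)
Lemma cdot_neq1 z w : cball z -> cball w -> 1 - cdot z w != 0.
Proof.
move=> z1 w1.
have linl (a : C) (x y u : 'rV[C]_n) :
    cdot (a *: x + y) u = a * cdot x u + cdot y u.
  rewrite /cdot mulr_sumr -big_split; apply: eq_bigr => i _ /=.
  by rewrite !mxE mulrDl mulrA.
have ge0 (x : 'rV[C]_n) : 0 <= cdot x x.
  by apply: sumr_ge0 => i _; rewrite mul_conjC_ge0.
have := CauchySchwarz_herm linl cdot_herm ge0 z w.
have lt1 : cdot z z * cdot w w < 1 by rewrite mulr_ilt1.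
rewrite subr_eq0; case: eqP => // <-; rewrite normr1 expr1n => h.
by have := le_lt_trans h lt1; rewrite ltxx.
Qed.

Lemma resolvent_eq (L : hilbertSpace R) (V : 'I_n -> {linear L -> L}) z xi x :
  row_isometry V -> cball z ->
  pencil V z x = xi <-> op_inv (pencil V z) xi = x.
Proof.
move=> isoV zb; have [S TS] := pencil_inv isoV zb.
rewrite (op_invE TS); case: TS => _ [TS ST]; split=> <-.
  by rewrite -[LHS](_ : (S \o pencil V z) x = _) // ST.
by rewrite -[LHS](_ : (pencil V z \o S) xi = _) // TS.
Qed.

(** With [Z = \sum_i z_i V_i] and [W = \sum_i w_i V_i], replace [xi] by
    [x - Z x] on the one side and by [y - W y] on the other; all that remains is
    [<x, y> - <Z x, W y>]. *)
Lemma resolvent_kernel (L : hilbertSpace R) (V : 'I_n -> {linear L -> L})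
    z w x y xi :
  row_isometry V -> pencil V z x = xi -> pencil V w y = xi ->
  ⟪2 *: x - xi, xi⟫ + ⟪2 *: y - xi, xi⟫^* = 2 * ((1 - cdot z w) * ⟪x, y⟫).
Proof.
move=> isoV.
rewrite /pencil; set Zx := \sum_i _; set Wy := \sum_i _ => xE yE.
have ZW : ⟪Zx, Wy⟫ = cdot z w * ⟪x, y⟫.
  exact: row_ip.
have Zx_E : Zx = x - xi by rewrite -xE opprB addrC subrK.
have Wy_E : Wy = y - xi by rewrite -yE opprB addrC subrK.
rewrite mulrBl mul1r -ZW Zx_E Wy_E -(ip_herm (inner L)).
rewrite !(linearBl, linearBr) !(linearZl_LR, linearZr_LR) /= conjC_nat.
ring.
Qed.

Lemma herglotz_psd f (L : hilbertSpace R) (V : 'I_n -> {linear L -> L}) xi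
    (t : R) :
  row_isometry V ->
  (forall z, cball z ->
     f z = ⟪2 *: op_inv (pencil V z) xi - xi, xi⟫ + 'i * t%:C%C) ->
  psd_kernel cball (fun z w => (f z + (f w)^*) / (1 - cdot z w)).
Proof.
move=> isoV fE m p c pb.
pose a k := op_inv (pencil V (p k)) xi.
have aE k : pencil V (p k) (a k) = xi by apply/resolvent_eq.
pose kernel k l := (f (p k) + (f (p l))^*) / (1 - cdot (p k) (p l)).
have K k l : kernel k l = 2 * ⟪a k, a l⟫.
  rewrite /kernel !fE // rmorphD rmorphM /= conjCi [t%:C%C^*](CrealP _); last first.
    by apply/complex_realP; exists t.
  rewrite mulNr addrACA subrr addr0 (resolvent_kernel isoV (aE k) (aE l)).
  by rewrite mulrCA mulrAC mulfV ?mul1r // cdot_neq1.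
have -> : \sum_k \sum_l c k * (c l)^* * kernel k l
  = 2 * `|\sum_k c k *: a k| ^+ 2.
  rewrite (norm_comb (@inner_normE _ L)) mulr_sumr; apply: eq_bigr => k _.
  by rewrite mulr_sumr; apply: eq_bigr => l _; rewrite K mulrCA.
by rewrite mulr_ge0 // exprn_ge0.
Qed.

End Herglotz.

(** * Row isometries extending a partial one *)

Section Shifts.
Context {R : realType}.
Local Notation C := R[i].

(** Sorting a combination of pairs by the first component splits the quadratic
    form into a sum of quadratic forms of [K]. *)
Lemma positive_kernel_delta (W : eqType) (X : Type) (K : X -> X -> C) :
  positive_kernel K ->
  positive_kernel (fun p q : W * X => (p.1 == q.1)%:R * K p.2 q.2).
Proof.
move=> psd s.
have [U Uu sU] : exists2 U : seq W, uniq U & [seq p <- s | p.2.1 \in U] = s.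
  exists (undup [seq p.2.1 | p <- s]); first exact: undup_uniq.
  apply/all_filterP.
  rewrite -(all_map (fun p => p.2.1) (mem (undup [seq p.2.1 | p <- s]))).
  by apply/allP => w; rewrite inE mem_undup.
have inU (F : C * (W * X) -> C) :
    \sum_(p <- s) F p = \sum_(p <- s | p.2.1 \in U) F p.
  by rewrite -[in LHS]sU big_filter.
pose cut (w : W) (p : C * (W * X)) := p.1 * (p.2.1 == w)%:R.
have split_words p q : p.2.1 \in U ->
    p.1 * q.1^* * ((p.2.1 == q.2.1)%:R * K p.2.2 q.2.2)
    = \sum_(w <- U) cut w p * (cut w q)^* * K p.2.2 q.2.2.
  move=> pU; rewrite (bigD1_seq p.2.1) //= big1 => [|w wp].
    by rewrite /cut eqxx mulr1 addr0 rmorphM /= conjC_nat eq_sym !mulrA.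
  by rewrite /cut [p.2.1 == w]eq_sym (negPf wp) mulr0 !mul0r.
have -> : \sum_(p <- s) \sum_(q <- s)
      p.1 * q.1^* * ((p.2.1 == q.2.1)%:R * K p.2.2 q.2.2)
  = \sum_(w <- U) \sum_(p <- s) \sum_(q <- s)
      cut w p * (cut w q)^* * K p.2.2 q.2.2.
  rewrite [RHS]exchange_big /= inU [RHS]inU; apply: eq_bigr => p pU.
  rewrite [RHS]exchange_big /=; apply: eq_bigr => q _.
  exact: split_words.
apply: sumr_ge0 => w _; have := psd [seq (cut w p, p.2.2) | p <- s].
rewrite big_map; congr (0 <= _); apply: eq_bigr => p _.
by rewrite big_map.
Qed.

Variable n : nat.

(** The Gram space of [delta_(u, v) K] on pairs (word, point): the points sit on
    the empty word, and prefixing by the letter [i] preserves the kernel, hence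
    induces the isometry [S i].  Words that start with distinct letters, or the
    empty word and a nonempty one, are orthogonal. *)
Lemma shifts (D : Type) (K : D -> D -> C) :
  (forall x y, K x y = (K y x)^*) -> positive_kernel K ->
  exists (L : hilbertSpace R) (a : D -> L) (S : 'I_n -> {linear L -> L}),
    [/\ forall x y, ⟪a x, a y⟫ = K x y, row_isometry S &
        forall i x d, ⟪S i x, a d⟫ = 0].
Proof.
move=> Kherm Kpsd.
pose K' (p q : seq 'I_n * D) := (p.1 == q.1)%:R * K p.2 q.2.
have K'herm p q : K' p q = (K' q p)^*.
  by rewrite /K' rmorphM /= conjC_nat -Kherm eq_sym.
have [L [phi [phiE total]]] := kolmogorov K'herm (positive_kernel_delta Kpsd).
pose push i (p : seq 'I_n * D) : L := phi (i :: p.1, p.2).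
have /choice[S HS] : forall i, exists S : {linear L -> L},
    (forall x y, ⟪S x, S y⟫ = ⟪x, y⟫) /\
    forall v, (forall p, ⟪push i p, v⟫ = 0) -> forall x, ⟪S x, v⟫ = 0.
  move=> i; have gram p q : ⟪phi p, phi q⟫ = ⟪push i p, push i q⟫.
    by rewrite !phiE /K' /= eqseq_cons eqxx.
  have [P [T [TP Porth Pfix _ Tperp]]] := partial_isometry gram.
  exists T; split=> // x y; rewrite TP.
  (* The family phi is total, so the initial projection is the identity. *)
  have Pid u : P u = u.
    apply/eqP; rewrite eq_sym -subr_eq0; apply/eqP/total => p.
    by rewrite -(proj1 (Pfix p)) Porth.
  by rewrite !Pid.
exists L, (fun d => phi ([::], d)), S; split.
- by move=> x y; rewrite phiE /K' eqxx mul1r.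
- apply/row_isometryP => i j x y; have [<-|ij] := eqVneq i j.
    by rewrite mul1r; case: (HS i).
  rewrite mul0r; apply: (proj2 (HS j)) => p.
  rewrite (ip_herm (inner L)) (proj2 (HS i)) ?conjC0 // => q.
  by rewrite /push phiE /K' /= eqseq_cons (negPf ij) mul0r.
- move=> i x d; apply: (proj2 (HS i)) => p.
  by rewrite /push phiE /K' /= mul0r.
Qed.

(** [T] sends [m k = \sum_i z k i *: S i (x k)] to [b k] and [P] is its initial
    projection.  The operator [U = T + (I - P)] is isometric on the range of
    [S]: there [I - P] takes its values in that range again, hence orthogonally
    to those of [T], which lie in the closed span of [b]. *)
Lemma extend_row_isometry (L : hilbertSpace R) (S : 'I_n -> {linear L -> L})
    (I : Type) (z : I -> 'I_n -> C) (x b : I -> L) :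
  row_isometry S ->
  (forall i u k, ⟪S i u, b k⟫ = 0) ->
  (forall k l, (\sum_i z k i * (z l i)^*) * ⟪x k, x l⟫ = ⟪b k, b l⟫) ->
  exists V : 'I_n -> {linear L -> L},
    [/\ forall i, bounded_op (V i), row_isometry V &
        forall k, \sum_i z k i *: V i (x k) = b k].
Proof.
move=> Siso Sb zxb; have orth := proj1 (row_isometryP S) Siso.
pose m k := \sum_i z k i *: S i (x k).
have gram k l : ⟪m k, m l⟫ = ⟪b k, b l⟫ by rewrite row_ip.
have [P [T [TP Porth PTfix Pperp Tperp]]] := partial_isometry gram.
have herm := ip_herm (inner L).
pose U : {linear L -> L} := T \+ (idfun \- P).
pose V i : {linear L -> L} := U \o S i.
have bP k y : ⟪b k, P y⟫ = 0.
  rewrite herm Pperp ?conjC0 // => l.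
  rewrite linear_sumlz big1 // => i _.
  by rewrite linearZl_LR /= Sb mulr0.
have bS k i y : ⟪b k, S i y⟫ = 0 by rewrite herm Sb conjC0.
have cross u i y : ⟪T u, S i y - P (S i y)⟫ = 0.
  by apply: Tperp => k; rewrite linearBr /= bS bP subrr.
have VV i j u v : ⟪V j u, V i v⟫ = (i == j)%:R * ⟪u, v⟫.
  have sum4 (p q p' q' : L) :
      ⟪p + q, p' + q'⟫ = ⟪p, p'⟫ + ⟪p, q'⟫ + (⟪q, p'⟫ + ⟪q, q'⟫).
    by rewrite linearDl !linearDr.
  rewrite -orth /= sum4 cross [⟪_ - _, T _⟫]herm cross conjC0 addr0 add0r TP.
  move: (S j u) (S i v) => y y'.
  rewrite -{4}[y](subrK (P y)) -{4}[y'](subrK (P y')) [in RHS](addrC (y - _)).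
  rewrite [in RHS](addrC (y' - _)) [in RHS]sum4 Porth.
  by rewrite [⟪P y, y' - _⟫]herm Porth conjC0 addr0 add0r.
exists V; split; last 1 first.
- move=> k; have [Pm Tm] := PTfix k.
  transitivity (U (m k)); last by rewrite /= Pm Tm subrr addr0.
  by rewrite /m linear_sum; apply: eq_bigr => i _; rewrite linearZ.
- move=> i; split; first exact: linearP.
  exists 1 => u; rewrite mul1r -(@ler_pXn2r _ 2) ?nnegrE // !inner_normE.
  by rewrite VV eqxx mul1r.
- by apply/row_isometryP.
Qed.

End Shifts.

(** * Realization of functions of positive Schur class *)

Section Realization.
Context {R : realType} {n : nat}.
Local Notation C := R[i].

Lemma cdot0r (z : 'rV[C]_n) : cdot z 0 = 0.
Proof. by rewrite /cdot big1 // => i _; rewrite mxE conjC0 mulr0. Qed.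

Lemma cball0 : cball (0 : 'rV[C]_n).
Proof. by rewrite /cball /= cdot0r ltr01. Qed.

Lemma schur_realization (f : 'rV[C]_n -> C) :
  psd_kernel cball (fun z w => (f z + (f w)^*) / (1 - cdot z w)) ->
  exists (L : hilbertSpace R) (V : 'I_n -> {linear L -> L}) (xi : L) (t : R),
     (forall i, bounded_op (V i)) /\ row_isometry V /\
     forall z, cball z ->
       f z = ⟪2 *: op_inv (pencil V z) xi - xi, xi⟫ + 'i * t%:C%C.
Proof.
move=> fpsd; pose D := {z : 'rV[C]_n | cball z}.
pose F (z w : 'rV[C]_n) := (f z + (f w)^*) / (1 - cdot z w).
(* Halving the kernel accounts for the factor 2 in front of the resolvent. *)
pose K (x y : D) := F (sval x) (sval y) / 2.
have Kherm x y : K x y = (K y x)^*.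
  rewrite /K /F !rmorphM /= !fmorphV rmorphB rmorph1 rmorphD /= conjCK.
  by rewrite -cdot_herm conjC_nat [_^* + _]addrC.
have Kpsd : positive_kernel K.
  move=> s; pose c k := (tnth (in_tuple s) k).1.
  pose p k := sval (tnth (in_tuple s) k).2.
  have -> : \sum_(p <- s) \sum_(q <- s) p.1 * q.1^* * K p.2 q.2 =
      (\sum_k \sum_l c k * (c l)^* * F (p k) (p l)) / 2.
    rewrite big_tnth mulr_suml; apply: eq_bigr => k _.
    rewrite big_tnth mulr_suml; apply: eq_bigr => l _.
    by rewrite /K mulrA.
  by rewrite mulr_ge0 ?invr_ge0 // fpsd // => k; apply: svalP.
have [L [a [S [aK Siso Sa]]]] := shifts n Kherm Kpsd.
pose o : D := exist _ 0 cball0.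
have K0 x : K x o = (f (sval x) + (f 0)^*) / 2.
  by rewrite /K /F /= cdot0r subr0 divr1.
have [||V [Vbd Viso Vb]] := @extend_row_isometry R n L S D
  (fun x i => sval x 0 i) a (fun x => a x - a o) Siso.
- by move=> i u k; rewrite linearBr /= !Sa subrr.
(* The Gram matrices agree because <0, w> = 0 implies
   K z w - K z 0 - K 0 w + K 0 0 = <z, w> K z w. *)
- move=> k l; rewrite linearBl !linearBr /= !aK !K0 [K o l]Kherm K0 /K /F /=.
  rewrite -[\sum_i _]/(cdot (sval k) (sval l)).
  have := cdot_neq1 (svalP k) (svalP l); move: (cdot _ _) => c c1.
  rewrite rmorphM rmorphD /= fmorphV conjCK rmorph_nat.
  by field.
pose t := complex.Re ('Im (f 0)).
exists L, V, (a o), t; do 2!split=> //; move=> z zb; pose x : D := exist _ z zb.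
have -> : op_inv (pencil V z) (a o) = a x.
  by apply/resolvent_eq => //; rewrite /pencil (Vb x) opprB addrC subrK.
rewrite RRe_real ?Creal_Im // linearBl /= linearZl_LR /= !aK !K0 /= ImE.
have i2 : 'i * 'i = -1 :> C by rewrite -expr2 sqrCi.
by rewrite !mulrA i2; field.
Qed.

End Realization.

Theorem theorem6p4 (R : realType) (n : nat) (f : 'rV[R[i]]_n -> R[i]) :
  holomorphic f ->
  (schur_plus f <->
   exists (L : hilbertSpace R) (V : 'I_n -> {linear L -> L}) (xi : L) (t : R),
     (forall i, bounded_op (V i)) /\ row_isometry V /\
     forall z, cball z ->
       f z = ⟪2 *: op_inv (pencil V z) xi - xi, xi⟫ + 'i * t%:C%C).
Proof.
move=> fhol; split=> [[_ fpsd]|]; first exact: schur_realization.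
move=> [L [V [xi [t [_ [isoV fE]]]]]]; split=> //.
exact: herglotz_psd isoV fE.
Qed.
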